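(* Let $p\ge3$ be an integer and let $G=\langle a,r\rangle$ be the generalised Fabrykowski–Gupta group defined below. Let $F$ be the free group on $\{\alpha,\rho\}$, put $\sigma_i=\rho^{\alpha^i}$ for $i\in\mathbb Z$ (so that indices of $\sigma$ may be read modulo $p$, as $\alpha^p$ is a relator below), and let $$\mathcal R=\Big\{\alpha^p\Big\}\cup\Big\{\big[\sigma_i^{\sigma_{i-1}^n},\sigma_j^{\sigma_{j-1}^m}\big] : 1\le i,j\le p,\ 2\le|i-j|\le p-2,\ 0\le m,n\le p-1\Big\}\cup\Big\{(\sigma_i^{\sigma_{i-1}^{n+1}})^{-1}\,\sigma_i^{\sigma_{i-1}^n\,\sigma_{i-1}^{\sigma_{i-2}^m}} : 1\le i\le p,\ 0\le m,n\le p-1\Big\}.$$ Let $\varphi$ be the endomorphism of $F$ with $\varphi(\alpha)=\rho^{\alpha^{-1}}$ and $\varphi(\rho)=\rho$. Then the finite ascending $L$-presentation $\langle\alpha,\rho\mid\emptyset\mid\{\varphi\}\mid\mathcal R\rangle$ defines $G$; that is, the homomorphism $F\to G$, $\alpha\mapsto a$, $\rho\mapsto r$, is surjective with kernel $\langle\bigcup_{k\ge0}\varphi^k(\mathcal R)\rangle^F$.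
   Context: Let $X=\mathbb Z/p\mathbb Z=\{0,\dots,p-1\}$ and $X^*$ the set of finite words over $X$. The permutations $a,r$ of $X^*$ are defined recursively (with empty word fixed) by: $a(xw)=(x+1)w$; $r(0w)=0\,r(w)$, $r(1w)=1\,a(w)$, $r(xw)=xw$ for $x\in\{2,\dots,p-1\}$, for all $x\in X$, $w\in X^*$. $G$ is the group of permutations of $X^*$ generated by $a$ and $r$ (for $p=3$ this is the Fabrykowski–Gupta group). Conventions: $x^y=y^{-1}xy$, $[x,y]=x^{-1}y^{-1}xy$. An $L$-presentation $\langle S\mid Q\mid\Phi\mid R\rangle$ defines $F_S/\langle Q\cup\bigcup_{\psi\in\Phi^*}\psi(R)\rangle^{F_S}$, $\Phi^*$ the monoid generated by $\Phi$; ascending means $Q=\emptyset$. *)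

(* Defs.v *)
From mathcomp Require Import all_boot all_order all_algebra.
Set Implicit Arguments. Unset Strict Implicit. Unset Printing Implicit Defensive.

Definition a_act (p : nat) (inv : bool) (w : seq 'I_p) : seq 'I_p :=
  match w with
  | [::] => [::]
  | x :: w' => (if inv then ord_pred x else ordS x) :: w'
  end.

Fixpoint r_act (p : nat) (inv : bool) (w : seq 'I_p) : seq 'I_p :=
  match w with
  | [::] => [::]
  | x :: w' =>
      if val x == 0 then x :: r_act inv w'
      else if val x == 1 then x :: a_act inv w'
      else w
  end.

Inductive gen := GA | GR.
(* a letter is a generator together with a flag "is inverted" *)
Definition letter := (gen * bool)%type.
Definition word := seq letter.

Definition linv (l : letter) : letter := (l.1, ~~ l.2).
Definition winv (u : word) : word := rev (map linv u).

(* right action convention: in a product u v, u acts first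
   (so that x^y = y^{-1} x y is the usual conjugation of the paper) *)
Definition act_letter (p : nat) (l : letter) (w : seq 'I_p) : seq 'I_p :=
  match l.1 with GA => a_act l.2 w | GR => r_act l.2 w end.
Definition act (p : nat) (u : word) (w : seq 'I_p) : seq 'I_p :=
  foldl (fun w l => act_letter l w) w u.

Definition alpha : word := [:: (GA, false)].
Definition rho : word := [:: (GR, false)].
Definition wpow (u : word) (n : nat) : word := flatten (nseq n u).
Definition wconj (x y : word) : word := winv y ++ x ++ y.
Definition wcomm (x y : word) : word := winv x ++ winv y ++ x ++ y.

Definition alpha_zpow (i : int) : word :=
  match i with
  | Posz n => wpow alpha n
  | Negz n => wpow (winv alpha) n.+1
  end.

Definition sigma (i : int) : word := wconj rho (alpha_zpow i).

Definition absdiff (i j : nat) : nat := maxn i j - minn i j.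

Definition Rels (p : nat) (w : word) : Prop :=
  w = wpow alpha p
  \/ (exists i j m n : nat,
        [/\ 1 <= i <= p, 1 <= j <= p, 2 <= absdiff i j <= p - 2, m < p & n < p]
        /\ w = wcomm (wconj (sigma i%:Z) (wpow (sigma (i%:Z - 1)) n))
                     (wconj (sigma j%:Z) (wpow (sigma (j%:Z - 1)) m)))
  \/ (exists i m n : nat,
        [/\ 1 <= i <= p, m < p & n < p]
        /\ w = winv (wconj (sigma i%:Z) (wpow (sigma (i%:Z - 1)) n.+1))
               ++ wconj (sigma i%:Z)
                        (wpow (sigma (i%:Z - 1)) n
                         ++ wconj (sigma (i%:Z - 1)) (wpow (sigma (i%:Z - 2)) m))).

Definition phi_gen (g : gen) : word :=
  match g with GA => wconj rho (winv alpha) | GR => rho end.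
Definition phi (u : word) : word :=
  flatten (map (fun l : letter => if l.2 then winv (phi_gen l.1) else phi_gen l.1) u).

Definition iterRels (p : nat) (w : word) : Prop :=
  exists (k : nat) (r : word), Rels p r /\ w = iter k phi r.

(* Words whose image in the free group F lies in the normal closure
   <S>^F of a set S of words: closed under free reduction / insertion of
   cancelling pairs, products, inverses, and containing all conjugates of
   elements of S. *)
Inductive nclos (S : word -> Prop) : word -> Prop :=
| nc_nil : nclos S [::]
| nc_rel u r : S r -> nclos S (winv u ++ r ++ u)
| nc_cat u v : nclos S u -> nclos S v -> nclos S (u ++ v)
| nc_inv u : nclos S u -> nclos S (winv u)
| nc_ins u v l : nclos S (u ++ v) -> nclos S (u ++ l :: linv l :: v)
| nc_del u v l : nclos S (u ++ l :: linv l :: v) -> nclos S (u ++ v).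

(* Main.v *)
(** Write [s_i = r^(a^i)]: it fixes the first letter, acts as [r] below the
letter [i], as [a] below [i + 1], and trivially elsewhere.  Soundness is read
off from these states: [phi u] acts as [u] below the letter 0 and as a power of
[a] or [r] below the letters 1 and [p - 1].

For completeness, let [c_x] be the state of a word [u] at the letter [x].
In every group satisfying the first level of the relations, the conjugates
[s_(i+1)^(s_i^n)] obey just enough commutation rules for [u] to be rebuilt from
its states as [u = (prod_x phi(c_x)^(a^x) s_(x-1)^(-e_x)) a^m], where [m] and
[e_x] are the exponent sums of [a] in [u] and in [c_x].  If [u] acts trivially,
then so do the [c_x], the exponents vanish modulo [p], and by induction on the
number of letters [r] each [c_x], hence [phi(c_x)], lies in the normal closure.
The induction fails only if one state receives all letters [r] of [u], and then
[u] is [s_x^n a^m] with [p] dividing [n] and [m]. *)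

From HB Require Import structures.
Require Import Defs.
From mathcomp Require Import all_boot all_order all_algebra.
From mathcomp Require Import boolp.
From mathcomp Require Import zify.
Set Implicit Arguments. Unset Strict Implicit. Unset Printing Implicit Defensive.

(** * Inversion of words, and the quotient of the words by a normal set *)

Definition bool_of_gen (g : gen) : bool := if g is GA then true else false.
Definition gen_of_bool (b : bool) : gen := if b then GA else GR.
Lemma bool_of_genK : cancel bool_of_gen gen_of_bool. Proof. by case. Qed.
HB.instance Definition _ := Choice.copy gen (can_type bool_of_genK).

Lemma linvK : involutive linv.
Proof. by case=> g b; rewrite /linv /= negbK. Qed.

Lemma winvK : involutive winv.
Proof. by move=> u; rewrite /winv map_rev revK mapK //; apply: linvK. Qed.

Lemma winv_cat u v : winv (u ++ v) = winv v ++ winv u.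
Proof. by rewrite /winv map_cat rev_cat. Qed.

Lemma winv_cons l u : winv (l :: u) = winv u ++ [:: linv l].
Proof. by rewrite /winv /= rev_cons cats1. Qed.

(** Both the words acting trivially and the normal closure have these properties, so one quotient
    construction serves for both. *)
Record normal_words (N : word -> Prop) : Prop := NormalWords {
  nw_nil : N [::];
  nw_cat u v : N u -> N v -> N (u ++ v);
  nw_inv u : N u -> N (winv u);
  nw_conj u v : N u -> N (winv v ++ u ++ v);
  nw_ins u v l : N (u ++ v) -> N (u ++ l :: linv l :: v);
  nw_del u v l : N (u ++ l :: linv l :: v) -> N (u ++ v) }.

Section CancelWords.
Variable N : word -> Prop.

Lemma insert_cancelling_words (u v w : word) :
  (forall u v l, N (u ++ v) -> N (u ++ l :: linv l :: v)) ->
  N (u ++ v) -> N (u ++ w ++ winv w ++ v).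
Proof.
move=> ins; elim: w u v => [|l w IH] u v H //=.
rewrite winv_cons -catA /= -cat_rcons; apply: IH.
by rewrite cat_rcons; apply: ins.
Qed.

Lemma delete_cancelling_words (u v w : word) :
  (forall u v l, N (u ++ l :: linv l :: v) -> N (u ++ v)) ->
  N (u ++ w ++ winv w ++ v) -> N (u ++ v).
Proof.
move=> del; elim: w u v => [|l w IH] u v //=.
rewrite winv_cons -catA /= -cat_rcons => /IH.
by rewrite cat_rcons => /del.
Qed.
End CancelWords.

Section QuotientGroup.
Variables (N : word -> Prop) (HN : normal_words N).

Lemma nw_delVw u v w : N (u ++ winv w ++ w ++ v) -> N (u ++ v).
Proof.
move=> H; apply: (delete_cancelling_words (w := winv w) (@nw_del _ HN)).
by rewrite winvK.
Qed.

(** Classical logic makes membership in [N] boolean, as [eq_quot] requires. *)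
Definition weqv (u v : word) : bool := `[< N (u ++ winv v) >].

Lemma weqvP u v : reflect (N (u ++ winv v)) (weqv u v).
Proof. exact: asboolP. Qed.

Lemma weqv_refl : reflexive weqv.
Proof.
move=> u; apply/weqvP; have := @insert_cancelling_words N [::] [::] u (@nw_ins _ HN) (nw_nil HN).
by rewrite cats0.
Qed.

Lemma weqv_sym : symmetric weqv.
Proof.
suff S u v : weqv u v -> weqv v u by move=> u v; apply/idP/idP; apply: S.
by move=> /weqvP /(nw_inv HN); rewrite winv_cat winvK => /weqvP.
Qed.

Lemma weqv_trans : transitive weqv.
Proof.
move=> v u w /weqvP uv /weqvP vw; apply/weqvP.
by have := nw_cat HN uv vw; rewrite -catA => /nw_delVw.
Qed.

Lemma weqv_cat u u' v v' : weqv u u' -> weqv v v' -> weqv (u ++ v) (u' ++ v').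
Proof.
move=> /weqvP uu' /weqvP vv'; apply/weqvP.
have := nw_cat HN uu' (nw_conj HN (winv u') vv').
by rewrite winvK winv_cat -!catA => /nw_delVw.
Qed.

Lemma weqv_inv u v : weqv u v -> weqv (winv u) (winv v).
Proof.
rewrite weqv_sym => /weqvP vu; apply/weqvP; rewrite winvK.
by apply: (@nw_delVw [::] _ v); rewrite catA; have := nw_conj HN v vu; rewrite -!catA.
Qed.

Definition weqv_equiv_rel : equiv_rel word := EquivRel weqv weqv_refl weqv_sym weqv_trans.
Canonical weqv_equiv_rel.

Definition word_quotient : Type := {eq_quot weqv}%qT.
HB.instance Definition _ := Choice.on word_quotient.
HB.instance Definition _ := EqQuotient.on word_quotient.

Implicit Types (x y z : word_quotient).
Local Notation cl u := (\pi_word_quotient u)%qT.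

Lemma cl_eq u v : weqv u v -> cl u = cl v.
Proof. by move=> H; apply/eqquotP. Qed.

Definition wq_mul x y := cl (repr x ++ repr y).
Definition wq_inv x := cl (winv (repr x)).

Lemma repr_cl u : weqv (repr (cl u)) u.
Proof. by have /eqquotP H := reprK (cl u). Qed.

Lemma wq_mulE u v : wq_mul (cl u) (cl v) = cl (u ++ v).
Proof. by apply/cl_eq/weqv_cat; apply: repr_cl. Qed.

Lemma wq_invE u : wq_inv (cl u) = cl (winv u).
Proof. by apply/cl_eq/weqv_inv/repr_cl. Qed.

Lemma clP x : exists u, x = cl u.
Proof. by exists (repr x); rewrite reprK. Qed.

Lemma wq_mulA : associative wq_mul.
Proof.
move=> x y z; case: (clP x) (clP y) (clP z) => [u ->] [v ->] [w ->].
by rewrite (wq_mulE v w) (wq_mulE u v) (wq_mulE u) (wq_mulE _ w) catA.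
Qed.

Lemma wq_mul1 : left_id (cl [::]) wq_mul.
Proof. by move=> x; case: (clP x) => u ->; rewrite (wq_mulE [::] u). Qed.

Lemma wq_mulr1 : right_id (cl [::]) wq_mul.
Proof. by move=> x; case: (clP x) => u ->; rewrite (wq_mulE u [::]) cats0. Qed.

Lemma wq_mulV : left_inverse (cl [::]) wq_inv wq_mul.
Proof.
move=> x; case: (clP x) => u ->; rewrite (wq_invE u) (wq_mulE _ u).
apply/cl_eq/weqvP; rewrite cats0.
by have /weqvP := weqv_refl (winv u); rewrite winvK.
Qed.

Lemma wq_mulrV : right_inverse (cl [::]) wq_inv wq_mul.
Proof.
move=> x; case: (clP x) => u ->; rewrite (wq_invE u) (wq_mulE u).
by apply/cl_eq/weqvP; rewrite cats0; have /weqvP := weqv_refl u.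
Qed.

HB.instance Definition _ :=
  isGroup.Build word_quotient wq_mulA wq_mul1 wq_mulr1 wq_mulV wq_mulrV.

Lemma cl_cat u v : cl (u ++ v) = (cl u * cl v)%g. Proof. by rewrite -wq_mulE. Qed.
Lemma cl_inv u : cl (winv u) = ((cl u)^-1)%g. Proof. by rewrite -wq_invE. Qed.
Lemma cl_eq1 u : cl u = 1%g <-> N u.
Proof.
split=> [/eqquotP /weqvP | H]; first by rewrite cats0.
by apply/cl_eq/weqvP; rewrite cats0.
Qed.
End QuotientGroup.

Local Open Scope group_scope.

(** * Evaluation of words in a group *)

Definition gsign (G : groupType) (b : bool) (x : G) : G := if b then x^-1 else x.

Definition ev (G : groupType) (x y : G) (u : word) : G :=
  \prod_(l <- u) gsign l.2 (if l.1 is GA then x else y).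

Section Eval.
Variable G : groupType.
Implicit Types (x y g : G) (u v : word).

Lemma ev_nil x y : ev x y [::] = 1. Proof. exact: big_nil. Qed.

Lemma ev_cat x y u v : ev x y (u ++ v) = ev x y u * ev x y v.
Proof. exact: big_cat. Qed.

Lemma ev_cons x y l u :
  ev x y (l :: u) = gsign l.2 (if l.1 is GA then x else y) * ev x y u.
Proof. exact: big_cons. Qed.

Lemma ev1 x y l : ev x y [:: l] = gsign l.2 (if l.1 is GA then x else y).
Proof. by rewrite ev_cons ev_nil mulg1. Qed.

Lemma ev_winv x y u : ev x y (winv u) = (ev x y u)^-1.
Proof.
elim: u => [|[g b] u IH]; first by rewrite /winv ev_nil invg1.
rewrite winv_cons ev_cat IH ev1 ev_cons invgM /=; congr (_ * _).
by case: b; rewrite //= invgK.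
Qed.

Lemma ev_wpow x y u n : ev x y (wpow u n) = ev x y u ^+ n.
Proof.
elim: n => [|n IH]; first by rewrite ev_nil.
by rewrite expgS -IH -ev_cat.
Qed.

Lemma ev_wconj x y u v : ev x y (wconj u v) = ev x y u ^ ev x y v.
Proof. by rewrite !ev_cat ev_winv. Qed.

Lemma ev_wcomm x y u v : ev x y (wcomm u v) = [~ ev x y u, ev x y v].
Proof. by rewrite !ev_cat !ev_winv. Qed.

Lemma ev_alpha x y : ev x y alpha = x. Proof. by rewrite ev1. Qed.
Lemma ev_rho x y : ev x y rho = y. Proof. by rewrite ev1. Qed.

(** Applying [phi] amounts to changing the pair of generators, so iterates of [phi] need no word
    calculus. *)
Lemma ev_phi x y u : ev x y (phi u) = ev (y ^ x^-1) y u.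
Proof.
have E h : ev x y (phi_gen h) = if h is GA then y ^ x^-1 else y.
  by case: h; rewrite /phi_gen ?ev_wconj ?ev_winv ?ev_alpha ev_rho.
elim: u => [|[g b] u IH]; first by rewrite !ev_nil.
rewrite /phi /= ev_cat ev_cons -/(phi u) IH /=; congr (_ * _).
by case: b; rewrite ?ev_winv E.
Qed.

Lemma evJ x y g u : ev (x ^ g) (y ^ g) u = ev x y u ^ g.
Proof.
elim: u => [|[h b] u IH]; first by rewrite !ev_nil conj1g.
by rewrite !ev_cons IH conjMg; case: h b => -[] /=; rewrite ?conjVg.
Qed.
End Eval.

(** Turns membership in [N] into an equation in a group. It is applied to the kernel of the action
    for soundness and to the normal closure for completeness. *)
Lemma word_quotient_exists (N : word -> Prop) : normal_words N ->
  exists (G : groupType) (a r : G), forall u, ev a r u = 1 <-> N u.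
Proof.
move=> HN; pose Q := @word_quotient N HN.
pose cl u : Q := (\pi_Q u)%qT.
exists Q, (cl alpha), (cl rho) => u.
suff -> : ev (cl alpha) (cl rho) u = cl u by apply: cl_eq1.
elim: u => [|[g b] u IH]; first by rewrite ev_nil.
rewrite ev_cons IH -cat1s /cl cl_cat; congr (_ * _).
by case: g b => -[] //=; rewrite -cl_inv.
Qed.

(** * Exponent sums modulo [p] *)

(* Exponents are natural numbers modulo [p]: an inverse letter counts for [p - 1]. *)
Definition lexp (p : nat) (b : bool) : nat := if b then p.-1 else 1%N.

Definition aexp (p : nat) (u : word) : nat :=
  \sum_(l <- u) (if l.1 is GA then lexp p l.2 else 0).
Definition rexp (p : nat) (u : word) : nat :=
  \sum_(l <- u) (if l.1 is GR then lexp p l.2 else 0).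
Definition rcount (u : word) : nat := count (fun l => ~~ bool_of_gen l.1) u.

Lemma aexp_cons p l u :
  aexp p (l :: u) = ((if l.1 is GA then lexp p l.2 else 0) + aexp p u)%N.
Proof. exact: big_cons. Qed.
Lemma rexp_cons p l u :
  rexp p (l :: u) = ((if l.1 is GR then lexp p l.2 else 0) + rexp p u)%N.
Proof. exact: big_cons. Qed.
Lemma aexp_cat p u v : aexp p (u ++ v) = (aexp p u + aexp p v)%N.
Proof. exact: big_cat. Qed.
Lemma rexp_cat p u v : rexp p (u ++ v) = (rexp p u + rexp p v)%N.
Proof. exact: big_cat. Qed.

Lemma gsignX (G : groupType) p b (x : G) :
  0 < p -> x ^+ p = 1 -> gsign b x = x ^+ lexp p b.
Proof.
case: p => // p _ xp; case: b; last by rewrite expg1.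
by rewrite /=; apply: mulg1_eq; rewrite -expgS.
Qed.

Lemma ev_aexp (G : groupType) p (x : G) u :
  0 < p -> x ^+ p = 1 -> ev x 1 u = x ^+ aexp p u.
Proof.
move=> p0 xp; elim: u => [|[[] b] u IH]; first by rewrite ev_nil /aexp big_nil.
  by rewrite ev_cons aexp_cons IH expgnDr /= (gsignX b p0 xp).
by rewrite ev_cons aexp_cons IH /=; case: b; rewrite /= ?invg1 mul1g.
Qed.

Lemma ev_rexp (G : groupType) p (x : G) u :
  0 < p -> x ^+ p = 1 -> ev 1 x u = x ^+ rexp p u.
Proof.
move=> p0 xp; elim: u => [|[[] b] u IH]; first by rewrite ev_nil /rexp big_nil.
  by rewrite ev_cons rexp_cons IH /=; case: b; rewrite /= ?invg1 mul1g.
by rewrite ev_cons rexp_cons IH expgnDr /= (gsignX b p0 xp).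
Qed.

Lemma expg_modn (G : groupType) p (x : G) n : x ^+ p = 1 -> x ^+ (n %% p) = x ^+ n.
Proof.
move=> xp; rewrite [in RHS](divn_eq n p) expgnDr mulnC expgnA xp.
by rewrite expg1n mul1g.
Qed.

Lemma expg_eqmod (G : groupType) p (x : G) m n :
  x ^+ p = 1 -> m = n %[mod p] -> x ^+ m = x ^+ n.
Proof. by move=> xp E; rewrite -(expg_modn m xp) E expg_modn. Qed.

Lemma expg_dvdn (G : groupType) p (x : G) n : x ^+ p = 1 -> p %| n -> x ^+ n = 1.
Proof. by move=> xp pn; rewrite (@expg_eqmod _ _ _ n 0 xp) // mod0n; apply/eqP. Qed.

Lemma eqmod_lt p i j : i < j < i + p -> (i == j %[mod p]) = false.
Proof.
move=> /andP[ij jp]; rewrite eq_sym eqn_mod_dvd ?(ltnW ij) //.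
by rewrite gtnNdvd ?subn_gt0 // ltn_subLR // ltnW.
Qed.

(** * States of words and the action on the tree *)

Section Sections.
Variable p : nat.

Definition rho_section (b : bool) (x : nat) : word :=
  if x == 0 %[mod p] then [:: (GR, b)]
  else if x == 1%N %[mod p] then [:: (GA, b)] else [::].

(* [sec x u] is the state of [u] at the letter [x] of the alphabet, read modulo [p]. *)
Fixpoint sec (x : nat) (u : word) : word :=
  match u with
  | [::] => [::]
  | (GA, b) :: u' => sec (x + lexp p b) u'
  | (GR, b) :: u' => rho_section b x ++ sec x u'
  end.

Lemma sec_cat x u v : sec x (u ++ v) = sec x u ++ sec (x + aexp p u) v.
Proof.
elim: u x => [|[[] b] u IH] x /=; first by rewrite /aexp big_nil addn0.
  by rewrite IH aexp_cons addnA.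
by rewrite IH aexp_cons catA.
Qed.

Lemma sec_mod x y u : x = y %[mod p] -> sec x u = sec y u.
Proof.
elim: u x y => [|[[] b] u IH] x y //= xy.
  by apply: IH; rewrite -modnDml xy modnDml.
by rewrite /rho_section xy (IH _ _ xy).
Qed.

(** Each letter r leaves at most one letter in a given state. The induction for completeness
    descends along this count. *)
Lemma rcount_sec x u : rcount (sec x u) <= rcount u.
Proof.
elim: u x => [|[[] b] u IH] x; rewrite /= ?IH //.
rewrite -[rcount (_ ++ _)]/(count _ _) count_cat.
apply: (@leq_add _ _ 1 _ _ (IH x)).
by rewrite /rho_section; case: ifP => // _; case: ifP.
Qed.

Hypothesis p_gt1 : 1 < p.
Let p_gt0 : 0 < p. Proof. exact: ltnW. Qed.

(** A letter r that writes r into the state at [x] writes a, with the same sign, into the state at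
    [x.+1]. The normal form depends on this link between neighbouring states. *)
Lemma rexp_sec x u : rexp p (sec x u) = aexp p (sec x.+1 u).
Proof.
elim: u x => [|[[] b] u IH] x /=; first by rewrite /rexp /aexp !big_nil.
  by rewrite IH.
rewrite rexp_cat aexp_cat IH; congr (_ + _)%N.
rewrite /rho_section -[x.+1]addn1 (_ : (x + 1 == 1 %[mod p]) = (x == 0 %[mod p])).
  2: exact: (eqn_modDr 1 x 0).
have [x0|x0] := eqVneq (x %% p) (0 %% p)%N.
  rewrite (_ : (x + 1 == 0 %[mod p]) = false).
    by rewrite /aexp /rexp !big_seq1.
  by rewrite -modnDml x0 modnDml !modn_small.
rewrite [RHS](_ : _ = 0)%N.
  by case: ifP => _; rewrite /rexp ?big_seq1 ?big_nil.
by case: ifP => _; rewrite /aexp ?big_seq1 ?big_nil.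
Qed.

Definition shift (x : 'I_p) (n : nat) : 'I_p := Ordinal (ltn_pmod (x + n) p_gt0).

Lemma act_cons u (x : 'I_p) w :
  act u (x :: w) = shift x (aexp p u) :: act (sec x u) w.
Proof.
elim: u x w => [|[[] b] u IH] x w.
- congr (_ :: _); apply/val_inj.
  by rewrite /= /aexp big_nil addn0 modn_small.
- have -> : act ((GA, b) :: u) (x :: w) = act u (shift x (lexp p b) :: w).
    congr (act u (_ :: w)); apply/val_inj; case: b => /=; last by rewrite addn1.
    by congr (_ %% _)%N; lia.
  rewrite IH aexp_cons; congr (_ :: _).
    by apply/val_inj; rewrite /= modnDml addnA.
  by congr (act _ w); rewrite /=; apply: sec_mod; rewrite /= modn_mod.
- have -> : act ((GR, b) :: u) (x :: w) = act u (x :: act (rho_section b x) w).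
    congr (act u _); rewrite /rho_section [(x %% _)%N]modn_small // !modn_small //.
    by rewrite /act_letter /=; case: (nat_of_ord x =P 0%N) => // _; case: (nat_of_ord x =P 1%N).
  rewrite IH aexp_cons; congr (_ :: _).
  by rewrite /= /act foldl_cat.
Qed.
End Sections.

Lemma act_cat p u v (w : seq 'I_p) : act (u ++ v) w = act v (act u w).
Proof. exact: foldl_cat. Qed.

Lemma a_actK p b : cancel (@a_act p b) (a_act (~~ b)).
Proof. by move=> [|x w] //=; case: b; rewrite /= ?ord_predK ?ordSK. Qed.

Lemma r_actK p b : cancel (@r_act p b) (r_act (~~ b)).
Proof.
elim=> [|x w IH] //=; case: ifP => /= [->|x0]; first by rewrite IH.
by case: ifP => /= [x1|x1]; rewrite x0 x1 ?a_actK.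
Qed.

Lemma act_letterK p l : cancel (@act_letter p l) (act_letter (linv l)).
Proof. by case: l => [[] b] w; [apply: a_actK | apply: r_actK]. Qed.

Lemma act_winv p u : cancel (@act p u) (act (winv u)).
Proof.
elim: u => [|l u IH] w //; rewrite winv_cons act_cat.
by rewrite -[act (l :: u) w]/(act u (act_letter l w)) IH; apply: act_letterK.
Qed.

Definition acts_trivially p (u : word) : Prop := forall w : seq 'I_p, act u w = w.

Lemma acts_trivially_normal p : normal_words (acts_trivially p).
Proof.
split=> [w|u v Hu Hv w|u Hu w|u v Hu w|u v l H w|u v l H w] //.
- by rewrite act_cat Hu Hv.
- by rewrite -{1}[w]Hu act_winv.
- by rewrite !act_cat Hu -{1}[v]winvK act_winv.
- by rewrite -[RHS]H !act_cat /act /= act_letterK.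
- by rewrite -[RHS]H !act_cat /act /= act_letterK.
Qed.

Lemma acts_triviallyP p u : 1 < p ->
  acts_trivially p u <-> p %| aexp p u /\ forall x, acts_trivially p (sec p x u).
Proof.
move=> p1; have p0 := ltnW p1; split=> [H|[H1 H2] [|x w]]; last 2 first.
- by elim: u {H1 H2} => [|[[] b] u IH].
- rewrite (act_cons p1) H2; congr (_ :: _); apply/val_inj.
  by rewrite /= -modnDmr (eqP H1) addn0 modn_small.
split=> [|x w].
  have := H [:: Ordinal p0]; rewrite (act_cons p1) => -[] /=.
  by rewrite add0n => /eqP.
have := H (Ordinal (ltn_pmod x p0) :: w); rewrite (act_cons p1) => -[_].
by rewrite (@sec_mod _ _ x) // modn_mod.
Qed.

(** * The relations of the first level in a group *)

Definition sg (G : groupType) (a r : G) (i : nat) : G := r ^ (a ^+ i).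
Definition tau (G : groupType) (a r : G) (i n : nat) : G :=
  sg a r i.+1 ^ (sg a r i ^+ n).

(** Indices are one lower than in the relators, so that predecessors stay in the natural numbers,
    and the exponents [m] and [n] are unbounded. *)
Record fg_relations (G : groupType) (p : nat) (a r : G) : Prop := FGRelations {
  fg_pow : a ^+ p = 1;
  fg_comm i j m n : i < j < p -> 2 <= j - i <= p - 2 ->
    commute (tau a r i m) (tau a r j n);
  fg_conj k m n : tau a r k.+1 n ^ tau a r k m = tau a r k.+1 n.+1 }.

Section Bridge.
Variables (G : groupType) (p : nat) (a r : G).
Local Notation s := (sg a r).
Local Notation T := (tau a r).

Lemma ev_sigma i : ev a r (sigma (Posz i)) = s i.
Proof. by rewrite /sigma ev_wconj ev_rho /alpha_zpow ev_wpow ev_alpha. Qed.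

Lemma ev_sigma_pred i : ev a r (sigma (Posz i.+1 - 1)%R) = s i.
Proof. by rewrite (_ : (Posz i.+1 - 1)%R = Posz i) ?ev_sigma //; lia. Qed.

Hypothesis p_gt0 : 0 < p.
Hypothesis ap : a ^+ p = 1.

Lemma sg_mod i j : i = j %[mod p] -> s i = s j.
Proof. by move=> ij; rewrite /sg (expg_eqmod ap ij). Qed.

Lemma tau_mod i j n : i = j %[mod p] -> T i n = T j n.
Proof.
move=> ij; rewrite /tau (sg_mod ij) (@sg_mod i.+1 j.+1) //.
by rewrite -addn1 -modnDml ij modnDml addn1.
Qed.

Lemma ev_sigma_pred2 i : ev a r (sigma (Posz i.+1 - 2)%R) = s (i + p).-1.
Proof.
(* For [i = 0] the integer index is -1, represented by [p.-1]. *)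
case: i => [|i].
  rewrite (_ : (Posz 1 - 2)%R = Negz 0); last by lia.
  rewrite /sigma ev_wconj ev_rho /alpha_zpow ev_wpow ev_winv ev_alpha /sg expg1.
  by congr (_ ^ _); apply: (gsignX true p_gt0 ap).
rewrite (_ : (Posz i.+2 - 2)%R = Posz i) ?ev_sigma; last by lia.
by rewrite addSn /=; apply: sg_mod; rewrite modnDr.
Qed.

Lemma ev_comm_relator i j m n :
  ev a r (wcomm (wconj (sigma (Posz i.+1)) (wpow (sigma (Posz i.+1 - 1)%R) n))
                (wconj (sigma (Posz j.+1)) (wpow (sigma (Posz j.+1 - 1)%R) m)))
  = [~ T i n, T j m].
Proof.
move: (ev_sigma i.+1) (ev_sigma_pred i) (ev_sigma j.+1) (ev_sigma_pred j).
move: (sigma _) (sigma _) (sigma _) (sigma _) => xi yi xj yj Exi Eyi Exj Eyj.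
by rewrite ev_wcomm !ev_wconj !ev_wpow Exi Eyi Exj Eyj.
Qed.

Lemma ev_conj_relator i m n :
  ev a r (winv (wconj (sigma (Posz i.+1)) (wpow (sigma (Posz i.+1 - 1)%R) n.+1))
          ++ wconj (sigma (Posz i.+1))
               (wpow (sigma (Posz i.+1 - 1)%R) n
                ++ wconj (sigma (Posz i.+1 - 1)%R) (wpow (sigma (Posz i.+1 - 2)%R) m)))
  = (T (i + p) n.+1)^-1 * T (i + p) n ^ T (i + p).-1 m.
Proof.
have E : (i + p).-1.+1 = (i + p)%N by lia.
move: (ev_sigma i.+1) (ev_sigma_pred i) (ev_sigma_pred2 i).
move: (sigma _) (sigma _) (sigma _) => x y z Ex Ey Ez.
rewrite ev_cat ev_winv !ev_wconj ev_cat ev_wconj !ev_wpow Ex Ey Ez.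
have E1 : s (i + p) = s i by apply: sg_mod; rewrite modnDr.
have E2 : s (i + p).+1 = s i.+1 by apply: sg_mod; rewrite -addSn modnDr.
by rewrite conjgM /tau E E1 E2.
Qed.

Hypothesis rp : r ^+ p = 1.

Lemma sg_pow i : s i ^+ p = 1.
Proof. by rewrite /sg -conjXg rp conj1g. Qed.

Lemma tau_modr k m n : m = n %[mod p] -> T k m = T k n.
Proof. by move=> mn; rewrite /tau (expg_eqmod (sg_pow k) mn). Qed.
End Bridge.

(** [tau] is periodic in its index by [a ^+ p = 1] and in its exponent by [r ^+ p = 1], so the
    finite ranges in [Rels] cover all cases. *)
Lemma Rels_fg_relations (G : groupType) (p : nat) (a r : G) : 0 < p -> r ^+ p = 1 ->
  (forall w, Rels p w -> ev a r w = 1) <-> fg_relations p a r.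
Proof.
move=> p0 rp; split=> [H | [ap hC hJ] w].
  have ap : a ^+ p = 1.
    by rewrite -{1}(ev_alpha a r) -ev_wpow; apply: H; left.
  split=> // [i j m n ij dij | k m n].
    rewrite (tau_modr a rp i (esym (modn_mod m p))) (tau_modr a rp j (esym (modn_mod n p))).
    apply/commgP/eqP; rewrite -ev_comm_relator; apply: H; right; left.
    exists i.+1, j.+1, (n %% p)%N, (m %% p)%N; split=> //.
    by split; rewrite ?ltn_mod //; rewrite /absdiff; lia.
  (* The relator with index [q.+1] evaluates to an identity about [tau] at [q + p], whence the
     choice of [q]. *)
  have [q qp qk] : exists2 q, q < p & (q + p = k.+1 %[mod p])%N.
    by exists (k.+1 %% p)%N; rewrite ?ltn_mod // modnDr modn_mod.
  have pqk : ((q + p).-1 = k %[mod p])%N.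
    by apply/eqP; rewrite -(eqn_modDr 1) !addn1 prednK ?addn_gt0 ?p0 ?orbT // qk.
  have [n' n'p n'n] : exists2 n', n' < p & (n = n' %[mod p])%N.
    by exists (n %% p)%N; rewrite ?ltn_mod // modn_mod.
  have [m' m'p m'm] : exists2 m', m' < p & (m = m' %[mod p])%N.
    by exists (m %% p)%N; rewrite ?ltn_mod // modn_mod.
  have n'n1 : (n.+1 = n'.+1 %[mod p])%N by rewrite -(addn1 n) -(addn1 n') -modnDml n'n modnDml.
  rewrite (tau_modr a rp _ n'n) (tau_modr a rp _ n'n1) (tau_modr a rp _ m'm).
  rewrite -(tau_mod _ ap n' qk) -(tau_mod _ ap n'.+1 qk) -(tau_mod _ ap m' pqk).
  apply/esym; rewrite -[RHS](mulVKg (tau a r (q + p) n'.+1)) -[LHS]mulg1; congr (_ * _).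
  rewrite -(ev_conj_relator r p0 ap q m' n'); apply/esym/H; right; right.
  by exists q.+1, m', n'.
case=> [->|[[i [j [m [n [[hi hj hij hm hn] ->]]]]] | [i [m [n [[hi hm hn] ->]]]]]].
- by rewrite ev_wpow ev_alpha.
- case: i j hi hj hij => [|i] [|j] // hi hj hij; rewrite ev_comm_relator.
  apply/eqP/commgP; move: hij; rewrite /absdiff => hij.
  have [lt_ij|le_ji] := ltnP i j; first by apply: hC; lia.
  by apply/commute_sym/hC; lia.
- case: i hi => // i hi; rewrite (ev_conj_relator r p0 ap).
  have E : (i + p)%N = (i + p).-1.+1 by lia.
  by rewrite {1 2}E hJ -E mulVg.
Qed.

(** * Rebuilding a word from its states *)

Section Decomposition.
Variables (G : groupType) (p : nat) (a r : G).
Hypothesis p_gt2 : 2 < p.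
Hypothesis rp : r ^+ p = 1.
Hypothesis rels : fg_relations p a r.
Local Notation s := (sg a r).
Local Notation T := (tau a r).

Let p_gt0 : 0 < p. Proof. by lia. Qed.
Let ap : a ^+ p = 1. Proof. exact: fg_pow rels. Qed.

Lemma gsign_sg k b : gsign b (s k) = s k ^+ lexp p b.
Proof. by apply: gsignX => //; apply: sg_pow. Qed.

Lemma tau0 k : T k 0 = s k.+1. Proof. by rewrite /tau expg0 conjg1. Qed.

Lemma tau_conj_sg k n e : T k n ^ (s k ^+ e) = T k (n + e).
Proof. by rewrite /tau -conjgM -expgnDr. Qed.

Lemma tau_conj_tau k n m e : T k.+1 n ^ (T k m ^+ e) = T k.+1 (n + e).
Proof.
elim: e n => [|e IH] n; first by rewrite expg0 conjg1 addn0.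
by rewrite expgS conjgM (fg_conj rels) IH addSnnS.
Qed.

(* The contribution of the state [w] at the letter [k + 1] to the normal form;
   the correcting power of [s k] puts it in the subgroup generated by the [T k n]. *)
Definition zfac k w : G := (ev (s k) 1 w)^-1 * ev (s k) (s k.+1) w.

Lemma zfac_alpha k w b : zfac k (rcons w (GA, b)) = zfac k w ^ gsign b (s k).
Proof. by rewrite /zfac -cats1 !ev_cat !ev1 /= invgM conjgE !mulgA. Qed.

Lemma zfac_rho k w b : zfac k (rcons w (GR, b)) = zfac k w * gsign b (s k.+1).
Proof.
rewrite /zfac -cats1 !ev_cat !ev1 /= invgM !mulgA; congr (_ * _ * _).
by case: b; rewrite /= ?invgK ?invg1 mul1g.
Qed.

(** Appending a letter a conjugates [zfac k w] by a power of [s k], and appending r multiplies it by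
    a power of [T k 0]; so it stays in the subgroup generated by the [T k m]. The exponent [n]
    absorbs the conjugations in the induction. *)
Lemma zfac_commute y k w n :
  (forall m, commute y (T k m)) -> commute y (zfac k w ^ (s k ^+ n)).
Proof.
move=> H; elim/last_ind: w n => [|w [[] b] IH] n.
- by rewrite /zfac !ev_nil invg1 mulg1 conj1g; apply: commute1.
- by rewrite zfac_alpha gsign_sg -conjgM -expgnDr; apply: IH.
- rewrite zfac_rho conjMg gsign_sg conjXg; apply: commuteM; first exact: IH.
  exact/commuteX/H.
Qed.

Lemma zfac_commute0 y k w : (forall m, commute y (T k m)) -> commute y (zfac k w).
Proof. by move=> H; have := zfac_commute w 0 H; rewrite expg0 conjg1. Qed.

(** Conjugation by any [T k m] raises the exponent in [T k.+1 n] by one, whatever [m] is, so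
    [zfac k w] acts only through the exponent sum of r in [w]. *)
Lemma tau_conj_zfac k w n m :
  T k.+1 n ^ (zfac k w ^ (s k ^+ m)) = T k.+1 (n + rexp p w).
Proof.
elim/last_ind: w n m => [|w [[] b] IH] n m.
- by rewrite /zfac !ev_nil invg1 mulg1 conj1g conjg1 /rexp big_nil addn0.
- rewrite zfac_alpha gsign_sg -conjgM -expgnDr IH.
  by rewrite -cats1 rexp_cat /rexp big_seq1 addn0.
- rewrite zfac_rho conjMg gsign_sg conjXg conjgM IH tau_conj_tau.
  by rewrite -cats1 rexp_cat /(rexp _ [:: _]) big_seq1 addnA.
Qed.

Lemma tau_conj_zfac0 k w n : T k.+1 n ^ zfac k w = T k.+1 (n + rexp p w).
Proof. by have := tau_conj_zfac k w n 0; rewrite expg0 conjg1. Qed.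

(* The state at the letter [p], that is 0, comes first in the normal form, and
   there the correcting power stands on the other side because [s p.-1] occurs
   in the last factor of the product. *)
Definition zlast w : G := ev (s p.-1) (s p) w * (ev (s p.-1) 1 w)^-1.

Definition normal_form (c : nat -> word) : G :=
  zlast (c p) * \prod_(i < p.-1) zfac i (c i.+1).

(* What right multiplication by [s j] (or its inverse) appends to the state at [x]. *)
Definition letter_at (b : bool) (j x : nat) : word :=
  if x == j %[mod p] then [:: (GR, b)]
  else if x == j.+1 %[mod p] then [:: (GA, b)] else [::].

Lemma letter_atE0 b j x : x = j %[mod p] -> letter_at b j x = [:: (GR, b)].
Proof. by move=> xj; rewrite /letter_at xj eqxx. Qed.

Lemma letter_atE1 b j x : x = j.+1 %[mod p] -> letter_at b j x = [:: (GA, b)].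
Proof.
move=> xj; rewrite /letter_at xj eqxx eq_sym eqmod_lt //.
by rewrite ltnSn -addn1 ltn_add2l; lia.
Qed.

Lemma letter_at_far b j x : j.+1 < x < j + p -> letter_at b j x = [::].
Proof. by move=> H; rewrite /letter_at ![x == _ %[mod p]]eq_sym !eqmod_lt //; lia. Qed.

Section Step.
Variables (c : nat -> word) (b : bool).
Let e := lexp p b.

Section Positive.
Variable j : nat.
Hypothesis jp : 0 < j < p.
Let c' x := c x ++ letter_at b j x.

(** The power [s j ^+ e] arises from the letter r in the state at [j]. It passes the next factor by
    conjugating it, which accounts for the letter a in the state at [j.+1], and it commutes with the
    later factors. *)
Lemma prod_step k : k < p ->
  \prod_(i < k) zfac i (c' i.+1) =
  \prod_(i < k) zfac i (c i.+1) * (if j <= k then s j ^+ e else 1).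
Proof.
elim: k => [|k IH] kp.
  by rewrite !big_ord0 mul1g; case: ifP => //; lia.
rewrite !big_ord_recr /= IH ?(ltnW kp) // {IH} /c'.
have [jk|kj] := leqP j k.
  rewrite (leqW jk); have [kj|kj] := eqVneq k j.
    rewrite kj letter_atE1 // cats1 zfac_alpha gsign_sg -/e.
    by rewrite conjgE !mulgA mulgK.
  rewrite letter_at_far; last by lia.
  rewrite cats0 -[LHS]mulgA -[RHS]mulgA; congr (_ * _); apply: zfac_commute0 => m.
  apply/commute_sym/commuteX/commute_sym.
  case: j jp jk kj => // j' jp' jk kj; rewrite -tau0.
  by apply: (fg_comm rels); lia.
rewrite mulg1; have [kj'|kj'] := eqVneq k.+1 j.
  rewrite -kj' leqnn letter_atE0 // cats1 zfac_rho gsign_sg -/e.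
  by rewrite mulgA.
rewrite leqNgt (_ : k.+1 < j) /=; last by lia.
rewrite /letter_at !eqmod_lt ?cats0 ?mulg1 //; lia.
Qed.

Lemma zlast_step : zlast (c' p) = zlast (c p).
Proof.
(* For [j = p.-1] the letter a appended at [p] is cancelled by the correcting power. *)
rewrite /c'; have [pj|pj] := eqVneq p j.+1.
  rewrite letter_atE1; last by rewrite -pj.
  by rewrite /zlast !ev_cat !ev1 /= invgM !mulgA mulgK.
by rewrite letter_at_far ?cats0 //; lia.
Qed.

Lemma normal_form_step_pos : normal_form c * gsign b (s j) = normal_form c'.
Proof.
have [lt_p le_j] : p.-1 < p /\ j <= p.-1 by lia.
by rewrite /normal_form zlast_step (prod_step lt_p) le_j gsign_sg -/e mulgA.
Qed.
End Positive.

Section Zero.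
Hypothesis c_exp : rexp p (c p.-1) = aexp p (c p).
Let c' x := c x ++ letter_at b 0 x.

(** Here [s 0] must travel left through the whole product to reach the state at 0. Crossing the last
    factor turns it into [y], which commutes with the middle factors and conjugates the factor of
    index 0 as [s 0] does. *)
Lemma normal_form_step_zero : normal_form c * gsign b (s 0) = normal_form c'.
Proof.
have sp0 : s p = s 0 by apply: (sg_mod r ap); rewrite modnn mod0n.
set d := aexp p (c p); set A := s p.-1 ^+ d.
set t := gsign b (s 0).
(* [h] represents [-d] modulo [p]. *)
pose h := (d * p.-1)%N.
have Ainv : A^-1 = s p.-1 ^+ h.
  apply: mulg1_eq; rewrite -expgnDr; apply: expg_dvdn (sg_pow _ rp _) _.
  by rewrite /h -mulnS prednK ?dvdn_mull.
pose y := t ^ A^-1.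
have yT : y = T p.-1 h ^+ e.
  rewrite /y /t gsign_sg conjXg -/e Ainv /tau prednK //.
  by rewrite sp0.
have EA : ev (s p.-1) 1 (c p) = A by apply: ev_aexp => //; apply: sg_pow.
have zl : zlast (c' p) = zlast (c p) * y.
  rewrite /c' letter_atE0 ?modnn ?mod0n //.
  rewrite /zlast !ev_cat !ev1 /= EA sp0 -/t.
  have -> : gsign b (1 : G) = 1 by case: (b); rewrite /= ?invg1.
  by rewrite mulg1 /y conjgE invgK !mulgA mulgVK.
have z0 : zfac 0 (c' 1) = zfac 0 (c 1) ^ t.
  by rewrite /c' letter_atE1 // cats1 zfac_alpha.
have zi i : 0 < i < p.-1 -> zfac i (c' i.+1) = zfac i (c i.+1).
  by move=> ip; rewrite /c' letter_at_far ?cats0 //; lia.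
(* Conjugation by [t] and by [y] both raise the exponent of [T p m] by [e], so [t * y^-1]
   centralises the factor of index 0. *)
have yz0 : zfac 0 (c 1) ^ t = zfac 0 (c 1) ^ y.
  suff /commgP/conjg_fixP E : commute (zfac 0 (c 1)) (t * y^-1).
    by rewrite -[in LHS](mulgVK y t) conjgM E.
  apply/commute_sym/zfac_commute0 => m; apply/commute_sym/commgP/conjg_fixP.
  have -> : T 0 m = T p m by apply: (tau_mod r ap); rewrite modnn mod0n.
  rewrite conjgM; apply: (canLR (conjgK _)).
  rewrite yT /t gsign_sg -/e -{1}sp0 tau_conj_sg -[in RHS](prednK p_gt0).
  by rewrite tau_conj_tau prednK.
have yzi i : 0 < i < p.-2 -> commute y (zfac i (c i.+1)).
  move=> ip; apply: zfac_commute0 => m; rewrite yT.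
  apply/commute_sym/commuteX; apply: (fg_comm rels); lia.
(* Crossing shifts the exponent [h] by [rexp p (c p.-1)], which is [d] by [c_exp], and [h + d]
   vanishes modulo [p]. *)
have yzl : zfac p.-2 (c p.-1) * t = y * zfac p.-2 (c p.-1).
  rewrite [RHS]conjgC; congr (_ * _); rewrite yT conjXg.
  have -> : p.-1 = p.-2.+1 by lia.
  rewrite tau_conj_zfac0 -[p.-2.+1](_ : p.-1 = _) ?c_exp -/d; last by lia.
  rewrite (@tau_modr _ p a r rp _ _ 0) ?tau0 ?prednK ?sp0 //; first by rewrite /t gsign_sg.
  by rewrite /h addnC -mulnS prednK // modnMl mod0n.
rewrite /normal_form zl -[RHS]mulgA -[LHS]mulgA; congr (_ * _).
(* The first and last factors are split off; for [p = 3] nothing is left between them. *)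
have [q pq] : exists q, p = q.+3 by exists (p - 3)%N; lia.
have E2 : q.+2 = p.-1 by rewrite pq.
have E1 : q.+1 = p.-2 by rewrite pq.
rewrite -E2 !(big_ord_recr q.+1) !(big_ord_recl q) /= E1.
have E3 : p.-2.+1 = p.-1 by rewrite pq.
have -> : c' p.-2.+1 = c p.-1 by rewrite E3 /c' letter_at_far ?cats0 //; lia.
have -> : \prod_(i < q) zfac (bump 0 i) (c' (bump 0 i).+1) =
          \prod_(i < q) zfac (bump 0 i) (c (bump 0 i).+1).
  by apply: eq_bigr => i _; apply: zi; rewrite /bump /=; have := ltn_ord i; lia.
rewrite E3 z0 yz0.
have yM : commute y (\prod_(i < q) zfac (bump 0 i) (c (bump 0 i).+1)).
  by apply: commute_prod => i _; apply: yzi; rewrite /bump /=; have := ltn_ord i; lia.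
move: (zfac 0 _) (zfac p.-2 _) (\prod_(i < q) _) yzl yM => z1 z2 M yzl yM.
rewrite -[LHS]mulgA yzl [LHS]mulgA -[z1 * M * y]mulgA -yM !mulgA.
by rewrite mulgV mul1g.
Qed.
End Zero.
End Step.

Lemma normal_form_step c b j : j < p -> rexp p (c p.-1) = aexp p (c p) ->
  normal_form c * gsign b (s j) = normal_form (fun x => c x ++ letter_at b j x).
Proof.
case: j => [|j] jp ce; first exact: normal_form_step_zero.
exact: normal_form_step_pos.
Qed.

Lemma normal_form_eq (c c' : nat -> word) : c =1 c' -> normal_form c = normal_form c'.
Proof.
by move=> E; rewrite /normal_form E; congr (_ * _); apply: eq_bigr => i _; rewrite E.
Qed.

Lemma ev_normal_form u : ev a r u = normal_form (sec p ^~ u) * a ^+ aexp p u.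
Proof.
elim/last_ind: u => [|u [[] b] IH].
- rewrite /normal_form /zlast /= !ev_nil invg1 !mul1g /aexp big_nil expg0 mulg1.
  by rewrite big1 // => i _; rewrite /zfac /= !ev_nil invg1 mulg1.
- rewrite -cats1 ev_cat IH ev1 /= aexp_cat /(aexp p [:: _]) big_seq1 /= expgnDr mulgA.
  congr (_ * _); last exact: gsignX.
  by congr (_ * _); apply: normal_form_eq => x; rewrite sec_cat /= cats0.
(* [j] is [-t] modulo [p], so that moving [a ^+ t] past r produces [s j]. *)
set t := aexp p u; pose j := ((p - t %% p) %% p)%N.
have jp : j < p by rewrite ltn_mod.
have jt : p %| j + t.
  rewrite /dvdn /j modnDml -modnDmr subnK ?modnn //.
  by rewrite ltnW // ltn_mod.
have Et : aexp p (u ++ [:: (GR, b)]) = t by rewrite aexp_cat /(aexp p [:: _]) big_seq1 addn0.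
have Er : a ^+ t * gsign b r = gsign b (s j) * a ^+ t.
  have -> : s j = r ^ a ^- t.
    by congr (_ ^ _); apply/esym/mulg1_eq; rewrite -expgnDr addnC (expg_dvdn ap).
  have -> : gsign b (r ^ a ^- t) = gsign b r ^ a ^- t by case: (b); rewrite /= ?conjVg.
  by rewrite conjgE invgK !mulgA mulgVK.
rewrite -cats1 ev_cat IH ev1 /= Et -mulgA Er mulgA; congr (_ * _).
(* The states of a word satisfy the side condition by [rexp_sec] at the letter [p.-1]. *)
rewrite normal_form_step //; last first.
  rewrite rexp_sec; last by lia.
  by rewrite prednK.
apply: normal_form_eq => x; rewrite sec_cat /= cats0; congr (_ ++ _).
rewrite /letter_at /rho_section -/t.
have E0 y z : (y + t == z + (j + t) %[mod p]) = (y == z + j %[mod p]).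
  by rewrite addnA eqn_modDr.
have E1 z : (x + t == z %[mod p]) = (x == z + j %[mod p]).
  rewrite -E0 (eqP (_ : z == z + (j + t) %[mod p])) // eq_sym.
  by rewrite -modnDmr (eqP jt) addn0.
by rewrite !E1 add0n add1n.
Qed.

Lemma normal_form_trivial c :
  (forall k, k < p -> p %| aexp p (c k.+1) /\ ev (s k) (s k.+1) (c k.+1) = 1) ->
  normal_form c = 1.
Proof.
move=> H; have E k : k < p -> ev (s k) 1 (c k.+1) = 1.
  move=> kp; rewrite (@ev_aexp _ p) ?(sg_pow a rp) //.
  by apply: (expg_dvdn (sg_pow a rp _)); case: (H k kp).
have lt_p : p.-1 < p by lia.
have := proj2 (H _ lt_p); have := E _ lt_p; rewrite (prednK p_gt0) => E1 E2.
rewrite /normal_form /zlast E1 E2 invg1 mulg1 mul1g.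
rewrite big1 // => i _; have ip : i < p by have := ltn_ord i; lia.
by rewrite /zfac E // (proj2 (H _ ip)) invg1 mulg1.
Qed.

(** Equal counts force every letter r of [u] to be read when [x] has been moved to 0, so each one
    contributes a power of the same conjugate [s x]. *)
Lemma ev_one_coordinate x u : rcount (sec p x u) = rcount u ->
  ev a r u = s x ^+ rexp p (sec p x u) * a ^+ aexp p u.
Proof.
rewrite -(@ev_rexp _ p (s x)) ?(sg_pow a rp) //.
elim: u x => [|[[] b] u IH] x /=.
- by rewrite !ev_nil /aexp big_nil mulg1.
- move=> /IH E; rewrite ev_cons E aexp_cons expgnDr /= (gsignX b p_gt0 ap).
  have -> : ev 1 (s (x + lexp p b)) (sec p (x + lexp p b) u) =
            ev 1 (s x) (sec p (x + lexp p b) u) ^ (a ^+ lexp p b).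
    by rewrite -evJ conj1g /sg -conjgM -expgnDr.
  by rewrite mulgA -conjgC -mulgA.
rewrite /rho_section; have [x0|x0] := ifP.
  rewrite /= ev_cons aexp_cons /= => -[/IH E]; rewrite ev_cons E /= mulgA add0n.
  by rewrite (sg_mod r ap (eqP x0)) /sg expg0 conjg1.
have := rcount_sec p x u.
by rewrite /rcount; case: ifP => _ /=; lia.
Qed.
End Decomposition.

(** * The relations hold in the action on the tree *)

Section TreeAction.
Variables (p : nat) (G : groupType) (a r : G).
Hypothesis p_gt2 : 2 < p.
Hypothesis G_acts : forall u, ev a r u = 1 <-> acts_trivially p u.

Let p_gt1 : 1 < p. Proof. by lia. Qed.
Let p_gt0 : 0 < p. Proof. by lia. Qed.

Lemma sec_wpow_alpha x n : sec p x (wpow alpha n) = [::].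
Proof. by elim: n x => //= n IH x; apply: IH. Qed.

Lemma aexp_wpow_alpha n : aexp p (wpow alpha n) = n.
Proof.
elim: n => [|n IH]; first by rewrite /aexp big_nil.
by rewrite -[wpow _ _]/(_ :: wpow alpha n) aexp_cons IH.
Qed.

Lemma sec_wpow_rho x n : sec p x (wpow rho n) = wpow (rho_section p false x) n.
Proof.
elim: n => // n IH.
by rewrite -[RHS]/(rho_section p false x ++ wpow _ n) -IH.
Qed.

Lemma aexp_wpow_rho n : aexp p (wpow rho n) = 0%N.
Proof.
elim: n => [|n IH]; first by rewrite /aexp big_nil.
by rewrite -[wpow _ _]/(_ :: wpow rho n) aexp_cons IH.
Qed.

Lemma action_ap : a ^+ p = 1.
Proof.
rewrite -{1}(ev_alpha a r) -ev_wpow; apply/G_acts/(acts_triviallyP _ p_gt1).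
by rewrite aexp_wpow_alpha dvdnn; split=> // x w; rewrite sec_wpow_alpha.
Qed.

(** The states of the word for [r ^+ p] are that word itself at 0, the word for [a ^+ p] at 1 and
    the empty word elsewhere, so induction on the tree word applies. *)
Lemma action_rp : r ^+ p = 1.
Proof.
rewrite -{1}(ev_rho a r) -ev_wpow; apply/G_acts; elim=> [|x w IH].
  by elim: (wpow _ _) => [|[[] b] u].
rewrite (act_cons p_gt1) sec_wpow_rho aexp_wpow_rho; congr (_ :: _).
  by apply/val_inj; rewrite /= addn0 modn_small.
rewrite /rho_section; case: ifP => // _; case: ifP => _.
  have : ev a r (wpow alpha p) = 1 by rewrite ev_wpow ev_alpha action_ap.
  by move=> /G_acts; apply.
by elim: (p in wpow _ p).
Qed.

(* [g] fixes the first letter and acts by [f x] below the letter [x]. *)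
Definition level_one (g : G) (f : nat -> G) : Prop :=
  exists u, [/\ ev a r u = g, p %| aexp p u & forall x, ev a r (sec p x u) = f x].

Lemma level_one_eq1 g f : level_one g f -> (forall x, f x = 1) -> g = 1.
Proof.
move=> [u [<- pu Eu]] f1; apply/G_acts/(acts_triviallyP _ p_gt1).
by split=> // x; apply/G_acts; rewrite Eu.
Qed.

Lemma sec_dvd x n u : p %| n -> sec p (x + n) u = sec p x u.
Proof. by move=> /eqP pn; apply: sec_mod; rewrite -modnDmr pn addn0. Qed.

Lemma level_one1 : level_one 1 (fun=> 1).
Proof. by exists [::]; rewrite /aexp big_nil; split=> // [|x]; rewrite ev_nil. Qed.

Lemma level_oneM g h f f' : level_one g f -> level_one h f' ->
  level_one (g * h) (fun x => f x * f' x).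
Proof.
move=> [u [<- pu Eu]] [v [<- pv Ev]]; exists (u ++ v).
rewrite aexp_cat dvdn_add ?ev_cat //; split=> // x.
by rewrite sec_cat sec_dvd // ev_cat Eu Ev.
Qed.

Lemma level_oneV g f : level_one g f -> level_one g^-1 (fun x => (f x)^-1).
Proof.
move=> [u [<- pu Eu]]; exists (winv u).
(* Exponent and states of the inverse are read off from the trivially acting word [u ++ winv u]. *)
have /G_acts/(acts_triviallyP _ p_gt1)[pa tr] : ev a r (u ++ winv u) = 1.
  by rewrite ev_cat ev_winv mulgV.
rewrite aexp_cat dvdn_addr // in pa; rewrite ev_winv; split=> // x.
have /G_acts := tr x; rewrite sec_cat sec_dvd // ev_cat Eu => E.
by rewrite (mulg1_eq E).
Qed.

Lemma level_oneX g f n : level_one g f -> level_one (g ^+ n) (fun x => f x ^+ n).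
Proof.
move=> L; elim: n => [|n IH]; first exact: level_one1.
case: (level_oneM L IH) => u [E1 E2 E3]; exists u; rewrite E1 expgS; split=> // x.
by rewrite E3 expgS.
Qed.

Lemma level_oneJ g h f f' : level_one g f -> level_one h f' ->
  level_one (g ^ h) (fun x => f x ^ f' x).
Proof. by move=> Lg Lh; apply: level_oneM (level_oneV Lh) (level_oneM Lg Lh). Qed.

Lemma level_one_ev g h f f' u : level_one g f -> level_one h f' ->
  level_one (ev g h u) (fun x => ev (f x) (f' x) u).
Proof.
move=> Lg Lh; elim: u => [|[c b] u IH].
  by exists [::]; rewrite /aexp big_nil !ev_nil; split=> // x; rewrite !ev_nil.
have Lc : level_one (gsign b (if c is GA then g else h))
                    (fun x => gsign b (if c is GA then f x else f' x)).
  by case: c b => -[] /=; rewrite /gsign; [apply: level_oneV | | apply: level_oneV |].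
case: (level_oneM Lc IH) => v [E1 E2 E3]; exists v; rewrite E1 ev_cons; split=> // x.
by rewrite E3 ev_cons.
Qed.

Lemma level_one_inj g h f f' : level_one g f -> level_one h f' ->
  (forall x, f x = f' x) -> g = h.
Proof.
move=> Lg Lh E; apply: divg1_eq; apply: level_one_eq1 (level_oneM Lg (level_oneV Lh)) _.
by move=> x; rewrite E mulgV.
Qed.

Definition sg_state (i x : nat) : G :=
  if x == i %[mod p] then r else if x == i.+1 %[mod p] then a else 1.

Lemma sg_state1 i x : x = i.+1 %[mod p] -> sg_state i x = a.
Proof. by move=> E; rewrite /sg_state E eqxx eq_sym eqmod_lt //; lia. Qed.

Lemma sg_state_far i x y : x = y %[mod p] ->
  (i.+1 < y < i + p) || (y < i < (y + p).-1) -> sg_state i x = 1.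
Proof.
rewrite /sg_state => -> /orP[H|H].
  by rewrite ![y == _ %[mod p]]eq_sym !eqmod_lt //; lia.
by rewrite !eqmod_lt //; lia.
Qed.

Variant sg_state_spec i x : G -> Prop :=
| SgState0 of x = i %[mod p] : sg_state_spec i x r
| SgState1 of x = i.+1 %[mod p] : sg_state_spec i x a
| SgStateN : sg_state_spec i x 1.

Lemma sg_stateP i x : sg_state_spec i x (sg_state i x).
Proof.
rewrite /sg_state; case: ifP => [/eqP E|_]; first exact: SgState0.
by case: ifP => [/eqP E|_]; [apply: SgState1 | apply: SgStateN].
Qed.

Lemma level_one_sg i : level_one (sg a r i) (sg_state i).
Proof.
(* The inverse of [a ^+ i] is written as the positive power [i * p.-1]. *)
exists (wpow alpha (i * p.-1) ++ rho ++ wpow alpha i).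
have E : p %| i * p.-1 + i by rewrite -mulnSr prednK ?dvdn_mull.
split.
- rewrite !ev_cat !ev_wpow ev_alpha ev_rho /sg conjgE; congr (_ * _).
  by apply/esym/mulg1_eq; rewrite -expgnDr addnC (expg_dvdn action_ap).
- by rewrite !aexp_cat !aexp_wpow_alpha /(aexp p rho) big_seq1.
move=> x; rewrite !sec_cat !sec_wpow_alpha aexp_wpow_alpha /= !cats0.
have Ez z : (x + i * p.-1 == z %[mod p]) = (x == z + i %[mod p]).
  by rewrite -(eqn_modDr i) -addnA -modnDmr (eqP E) addn0.
rewrite /rho_section !Ez add0n add1n /sg_state.
by do 2![case: ifP => _; rewrite ?ev_nil ?ev1 //].
Qed.

Lemma level_one_tau i n :
  level_one (tau a r i n) (fun x => sg_state i.+1 x ^ (sg_state i x ^+ n)).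
Proof. by apply: level_oneJ (level_one_sg _) (level_oneX _ (level_one_sg _)). Qed.

(** The only nontrivial states of [tau a r i n] are [r ^ (a ^+ n)] at [i + 1] and [a] at [i + 2]. So
    the commutators have disjoint supports, while in [fg_conj] the conjugator acts as [a] at [k + 2]
    and trivially at [k + 3]. *)
Lemma action_fg_relations : fg_relations p a r.
Proof.
split=> [|i j m n ij dij|k m n]; first exact: action_ap.
  apply: (level_one_inj (level_oneM (level_one_tau i m) (level_one_tau j n))
                        (level_oneM (level_one_tau j n) (level_one_tau i m))) => x.
  case: (sg_stateP i.+1 x) => [E|E|]; last by rewrite conj1g mulg1 mul1g.
    by rewrite (@sg_state_far j.+1 x _ E) ?conj1g ?mulg1 ?mul1g //; lia.
  by rewrite (@sg_state_far j.+1 x _ E) ?conj1g ?mulg1 ?mul1g //; lia.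
apply: (level_one_inj (level_oneJ (level_one_tau k.+1 n) (level_one_tau k m))
                      (level_one_tau k.+1 n.+1)) => x.
case: (sg_stateP k.+2 x) => [E|E|]; last by rewrite !conj1g.
  rewrite (sg_state1 E) (@sg_state_far k x _ E); last by lia.
  by rewrite expg1n conjg1 -conjgM -expgSr.
rewrite (@sg_state_far k.+1 x _ E); last by lia.
by rewrite conj1g !expg1n !conjg1.
Qed.

(** The states of [phi u] are the values of [u] at [(a, r)] below 0, [(1, a)] below 1, [(r, 1)]
    below [p - 1] and [(1, 1)] elsewhere. All pairs but the first commute and fall under the first
    hypothesis. *)
Lemma action_phi u :
  (forall x y : G, commute x y -> x ^+ p = 1 -> y ^+ p = 1 -> ev x y u = 1) ->
  ev a r u = 1 -> ev a r (phi u) = 1.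
Proof.
move=> ab u1; rewrite ev_phi.
have -> : r ^ a^-1 = sg a r p.-1.
  by congr (_ ^ _); apply: (gsignX true p_gt0 action_ap).
have {2}-> : r = sg a r 0 by rewrite /sg expg0 conjg1.
apply: level_one_eq1 (level_one_ev u (level_one_sg _) (level_one_sg _)) _ => x.
have c1 (y : G) : commute y 1 by apply: commute1.
case: (sg_stateP 0 x) => [E|E|].
- by rewrite sg_state1 // prednK // modnn E mod0n.
- rewrite (@sg_state_far p.-1 x _ E); last by lia.
  by apply: ab; rewrite ?expg1n ?action_ap //; apply/commute_sym.
- by case: sg_stateP => *; apply: ab; rewrite ?expg1n ?action_ap ?action_rp.
Qed.
End TreeAction.

(** * Comparison of the normal closure with the kernel *)

Lemma Rels_commute (p : nat) (G : groupType) (x y : G) w : 0 < p ->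
  Rels p w -> commute x y -> x ^+ p = 1 -> y ^+ p = 1 -> ev x y w = 1.
Proof.
move=> p0 Rw xy xp yp.
have Es i : sg x y i = y by apply/conjg_fixP/commgP/commuteX/commute_sym.
have Et i n : tau x y i n = y.
  by rewrite /tau !Es; apply/conjg_fixP/commgP/commuteX.
apply: (Rels_fg_relations x p0 yp).2 Rw; split=> // [i j m n _ _|k m n]; rewrite !Et //.
by rewrite conjgE mulKg.
Qed.

(** On a commuting pair, [phi] replaces [(x, y)] by [(y, y)], again a commuting pair of exponent
    [p]. *)
Lemma iterRels_commute (p : nat) (G : groupType) (x y : G) w : 0 < p ->
  iterRels p w -> commute x y -> x ^+ p = 1 -> y ^+ p = 1 -> ev x y w = 1.
Proof.
move=> p0 [k [w0 [Rw0 ->]]]; elim: k x y => [|k IH] x y xy xp yp.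
  exact: Rels_commute Rw0 _ _ _.
rewrite /= ev_phi; have -> : y ^ x^-1 = y.
  by apply/conjg_fixP/commgP/commuteV/commute_sym.
exact: IH.
Qed.

(** [nclos] conjugates only the relators; conjugates of its other elements are obtained by
    induction. *)
Lemma nclos_normal (S : word -> Prop) : normal_words (nclos S).
Proof.
split; [exact: nc_nil | exact: nc_cat | exact: nc_inv | | exact: nc_ins | exact: nc_del].
move=> u v; elim=> {u} [|u x Sx|u w _ IHu _ IHw|u _ IH|u w l _ IH|u w l _ IH].
- by have := @insert_cancelling_words (nclos S) [::] [::] (winv v) (@nc_ins S) (nc_nil S);
  rewrite winvK cats0.
- by have := nc_rel (u ++ v) Sx; rewrite winv_cat -!catA.
- rewrite -catA catA; apply: (delete_cancelling_words (w := v) (@nc_del S)).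
  by have := nc_cat IHu IHw; rewrite -!catA.
- by have := nc_inv IH; rewrite !winv_cat winvK -!catA.
- by move: IH; rewrite -!catA /= !(catA (winv v) u); apply: nc_ins.
- by move: IH; rewrite -!catA /= !(catA (winv v) u); apply: nc_del.
Qed.

Lemma nclos_acts_trivially (p : nat) u : 2 < p -> nclos (iterRels p) u ->
  acts_trivially p u.
Proof.
move=> p2; have p0 : 0 < p by lia.
have [G [a [r HG]]] := word_quotient_exists (acts_trivially_normal p).
move=> nu; apply/HG; elim: nu => {u} [|u x [k [w [Rw ->]]]|u v _ IHu _ IHv|u _ IH|u v l _|u v l _].
- exact: ev_nil.
- rewrite -/(wconj _ u) ev_wconj; apply/eqP; rewrite conjg_eq1; apply/eqP.
  (* [action_phi] carries triviality from one iterate to the next, with [iterRels_commute] for its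
     condition on commuting pairs. *)
  elim: k => [|k IH].
    apply: (Rels_fg_relations a p0 (action_rp p2 HG)).2 Rw.
    exact: action_fg_relations.
  apply: (action_phi p2 HG) => // c d cd cp dp; apply: iterRels_commute cd cp dp => //.
  by exists k, w.
- by rewrite ev_cat IHu IHv mulg1.
- by rewrite ev_winv IH invg1.
- by rewrite !ev_cat !ev_cons; case: l => [[] []] /= <-; rewrite ?mulKg ?mulVKg.
- by rewrite !ev_cat !ev_cons; case: l => [[] []] /=; rewrite ?mulKg ?mulVKg.
Qed.

Lemma acts_trivially_nclos (p : nat) u : 2 < p -> acts_trivially p u ->
  nclos (iterRels p) u.
Proof.
move=> p2; have [p0 p1] : 0 < p /\ 1 < p by lia.
have [G [a [r HG]]] := word_quotient_exists (nclos_normal (iterRels p)).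
have rel1 k w : Rels p w -> ev a r (iter k phi w) = 1.
  move=> Rw; apply/HG; have := @nc_rel (iterRels p) [::] (iter k phi w).
  by rewrite /winv /= cats0; apply; exists k, w.
(* The image of [wpow alpha p] under [phi] evaluates to a conjugate of [r ^+ p]. *)
have rp : r ^+ p = 1.
  have := rel1 1%N (wpow alpha p) (or_introl erefl).
  by rewrite /= ev_phi ev_wpow ev_alpha -conjXg => /eqP; rewrite conjg_eq1 => /eqP.
have rels : fg_relations p a r.
  by apply/(Rels_fg_relations a p0 rp) => w; apply: (rel1 0%N).
(* The relators are stable under [phi], hence so is their normal closure; the left side is the value
   of [phi w]. *)
have phi1 w : nclos (iterRels p) w -> ev (r ^ a^-1) r w = 1.
  elim=> {w} [|v x [k [w [Rw ->]]]|v w _ IHv _ IHw|v _ IH|v w l _|v w l _].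
  - exact: ev_nil.
  - by rewrite -/(wconj _ v) ev_wconj -ev_phi (rel1 k.+1) ?conj1g.
  - by rewrite ev_cat IHv IHw mulg1.
  - by rewrite ev_winv IH invg1.
  - by rewrite !ev_cat !ev_cons; case: l => [[] []] /= <-; rewrite ?mulKg ?mulVKg.
  - by rewrite !ev_cat !ev_cons; case: l => [[] []] /=; rewrite ?mulKg ?mulVKg.
have ap := fg_pow rels.
have [n le_n] := ubnP (rcount u); elim: n u le_n => // n IH u le_n tu; apply/HG.
have [pu tsec] := (acts_triviallyP u p1).1 tu.
have pa x : p %| aexp p (sec p x u).
  by have [] := (acts_triviallyP _ p1).1 (tsec x).
(* If the state at [k] keeps all letters r, the induction cannot descend. Then the exponent of [s k]
   is the exponent sum of a in the state at [k.+1], which [p] divides. *)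
have [/existsP[k /eqP Ek]|/existsPn nE] :=
  boolP [exists k : 'I_p, rcount (sec p k u) == rcount u].
  rewrite (ev_one_coordinate p2 rp rels Ek) rexp_sec //.
  by rewrite (expg_dvdn (sg_pow a rp _)) // (expg_dvdn ap) // mulg1.
rewrite (ev_normal_form p2 rp rels) (expg_dvdn ap pu) mulg1.
apply: normal_form_trivial => // k kp; split=> //.
(* The pair [s k], [s k.+1] is the pair [r ^ a^-1], [r] conjugated by [a ^+ k.+1], so [phi1] applies
   to the state. *)
have -> : sg a r k = (r ^ a^-1) ^ (a ^+ k.+1) by rewrite -conjgM expgS mulKg.
rewrite evJ phi1 ?conj1g //; apply: IH => //.
have := nE (Ordinal (ltn_pmod k.+1 p0)); rewrite /= (@sec_mod _ _ k.+1) ?modn_mod //.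
by have := rcount_sec p k.+1 u; lia.
Qed.

Theorem mainTheorem8 (p : nat) (hp : 3 <= p) :
  forall u : word,
    (forall w : seq 'I_p, act u w = w) <-> nclos (iterRels p) u.
Proof.
by move=> u; split; [apply: acts_trivially_nclos | apply: nclos_acts_trivially].
Qed.
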